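(* Let $G=(V,E)$ be a finite simple undirected graph. Label each edge $e=\{u,v\}\in E$ by the set of its two end vertices, $[e]=\{u,v\}\subseteq V$ (so the universal set is $U=V$), and for $S\subseteq E$ let $[S]=\bigcup_{e\in S}[e]$. Let $S\subseteq E$ be the edge set of a shortest path in $G$ between two vertices. Then there are no false positives for $S$; that is, there is no edge $f\in E$ with $f\notin S$ and $[f]\subseteq[S]$.
   Context: A labelling of the edges of a graph $G=(V,E)$ with universal set $U$ assigns to each edge $e\in E$ a subset $[e]\subseteq U$; for $S\subseteq E$ one puts $[S]=\bigcup_{e\in S}[e]$ (so $[\emptyset]=\emptyset$). A false positive for $S$ is an edge $f\in E$ such that $f\notin S$ but $[f]\subseteq[S]$. A shortest path from $u$ to $v$ is a path from $u$ to $v$ with the minimum possible number of edges among all paths from $u$ to $v$ in $G$; it is identified with its set of edges, and paths with $0$ edges are allowed. The labelling in the claim is called the bit-per-vertex labelling. *)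

(* Defs.v *)
From mathcomp Require Import all_boot.

Set Implicit Arguments.
Unset Strict Implicit.
Unset Printing Implicit Defensive.

(* A finite simple graph is a symmetric irreflexive adjacency relation on a
   finite type; an edge is the two-element set of its end vertices. *)
Definition edges (V : finType) (adj : rel V) : {set {set V}} :=
  [set e | [exists x, exists y, adj x y && (e == [set x; y])]].

(* A labelling is a function on the whole ambient type of potential edges;
   only its values on the edges of the graph are ever used. *)
Definition label_union (L U : finType) (lab : L -> {set U}) (S : {set L}) :
    {set U} :=
  \bigcup_(e in S) lab e.

Definition false_positive (L U : finType) (E : {set L}) (lab : L -> {set U})
    (S : {set L}) (f : L) : Prop :=
  [/\ f \in E, f \notin S & lab f \subset label_union lab S].

(* Since edges are encoded as sets of end vertices, the label of an edge is
   the edge itself. *)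
Definition bit_per_vertex (V : finType) (e : {set V}) : {set V} := e.

(* The sequence u :: p lists the vertices of the path, so that size p is its
   number of edges and p = [::] is the path with no edges. *)
Definition is_path_between (V : finType) (adj : rel V) (u v : V) (p : seq V) :
    Prop :=
  [/\ path adj u p, last u p = v & uniq (u :: p)].

Definition shortest_path (V : finType) (adj : rel V) (u v : V) (p : seq V) :
    Prop :=
  is_path_between adj u v p /\
  forall q : seq V, is_path_between adj u v q -> size p <= size q.

Definition path_edges (V : finType) (u : V) (p : seq V) : {set {set V}} :=
  [set e in pairmap (fun x y => [set x; y]) u p].

(* Main.v *)
Require Import Defs.
From mathcomp Require Import all_boot.

(** A shortest path has no chord: an edge joining two of its vertices that are
    not consecutive would give a shortcut. A false positive for the
    bit-per-vertex labelling would be exactly such a chord. *)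

(** Going from [last u p1] straight to [y] skips the vertices of [p2] before [y]. By minimality
    there are none, so the path itself takes this edge. *)
Lemma shortest_path_forward_edge (V : finType) (adj : rel V) (u v y : V)
    (p1 p2 : seq V) :
  shortest_path adj u v (p1 ++ p2) -> y \in p2 -> adj (last u p1) y ->
  [set last u p1; y] \in path_edges u (p1 ++ p2).
Proof.
move=> [[pathP lastP uniqP] minP] y_p2 adj_y.
case/splitPr: y_p2 pathP lastP uniqP minP => p3 p4.
rewrite !cat_path !last_cat /= => /and4P[path1 _ _ path4] last4 uniqP minP.
(* As a subsequence of the path, the shortcut repeats no vertex. *)
have sub_q : subseq (u :: p1 ++ y :: p4) (u :: p1 ++ p3 ++ y :: p4).
  by rewrite /= eqxx cat_subseq // suffix_subseq.
have : size (p1 ++ p3 ++ y :: p4) <= size (p1 ++ y :: p4).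
  apply: minP; split; last exact: subseq_uniq sub_q uniqP.
  - by rewrite cat_path path1 /= adj_y.
  - by rewrite last_cat.
rewrite !size_cat leq_add2l -{2}(add0n (size (y :: p4))) leq_add2r leqn0.
by move=> /nilP ->; rewrite inE pairmap_cat /= mem_cat mem_head orbT.
Qed.

Lemma shortest_path_chordless (V : finType) (adj : rel V) (u v x y : V)
    (p : seq V) :
  symmetric adj -> irreflexive adj -> shortest_path adj u v p ->
  x \in u :: p -> y \in u :: p -> adj x y -> [set x; y] \in path_edges u p.
Proof.
move=> adj_sym adj_irr hp x_p y_p adj_xy.
case/splitPl: x_p hp y_p => p1 p2 last1 hp.
rewrite -cat_cons mem_cat => /orP[y_p1|y_p2]; last first.
  by rewrite -last1; apply: (@shortest_path_forward_edge _ adj u v); rewrite ?last1.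
(* Here [y] does not come after [x]; the roles are swapped, and the shortcut runs from [y] to
   [x]. *)
case/splitPl: y_p1 last1 hp => p3 p4 last3.
rewrite last_cat last3 -catA setUC => last4 hp.
rewrite -last3; apply: (@shortest_path_forward_edge _ adj u v) => //.
  (* [x] ends the segment [p4], which is nonempty: otherwise [x = y] and the edge would be a
     loop. *)
  rewrite mem_cat; apply/orP; left.
  case: p4 last4 {hp} => [|z p4] /= last4; last by rewrite -last4 mem_last.
  by rewrite last4 adj_irr in adj_xy.
by rewrite last3 adj_sym.
Qed.

(** This places both ends of a false positive on the path. The inclusion is strict for [p = [::]],
    where the union is empty. *)
Lemma label_union_path_edges (V : finType) (u : V) (p : seq V) :
  label_union (@bit_per_vertex V) (path_edges u p) \subset u :: p.
Proof.
apply/subsetP => z /bigcupP[e]; rewrite inE => e_p.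
elim: p u e_p => //= w p IHp u; rewrite inE => /orP[/eqP->|e_p z_e].
  by rewrite !inE => /orP[]->; rewrite ?orbT.
by rewrite inE (IHp w) ?orbT.
Qed.

Theorem proposition1 (V : finType) (adj : rel V)
    (adj_sym : symmetric adj) (adj_irr : irreflexive adj)
    (u v : V) (p : seq V) (S : {set {set V}})
    (hp : shortest_path adj u v p) (hS : S = path_edges u p) :
  ~ exists f : {set V}, false_positive (edges adj) (@bit_per_vertex V) S f.
Proof.
case=> f []; rewrite hS inE => /existsP[x /existsP[y /andP[adj_xy /eqP->]]].
move=> /negP notS sub_f; apply: notS.
have /subsetP in_p := subset_trans sub_f (label_union_path_edges V u p).
apply: shortest_path_chordless adj_sym adj_irr hp _ _ adj_xy; apply: in_p.
  exact: set21.
exact: set22.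
Qed.
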